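(* Let $R$ be a commutative non-reduced ring with identity. Then $AG(R)$ is planar if and only if one of the following statements holds: (1) $R$ is ring-isomorphic to either $\mathbb{Z}_2\times\mathbb{Z}_4$ or $\mathbb{Z}_2\times\mathbb{Z}_2[X]/(X^2)$. (2) $\mathrm{Ann}(Z(R))$ is a prime ideal of $R$ and $2\leq|\mathrm{Nil}(R)|\leq 3$. (3) $Z(R)=\mathrm{Nil}(R)$ and $4\leq|\mathrm{Nil}(R)|\leq 5$.
   Context: For a commutative ring $R$ with identity, $Z(R)$ is the set of zero-divisors of $R$ (including $0$), $Z(R)^*=Z(R)\setminus\{0\}$, $\mathrm{Nil}(R)$ is the set of nilpotent elements of $R$, $ann_R(x)=\{r\in R : rx=0\}$, and $\mathrm{Ann}(Z(R))=\{r\in R : rz=0 \text{ for all } z\in Z(R)\}$. A ring is non-reduced if it has a nonzero nilpotent element. The annihilator graph $AG(R)$ is the undirected simple graph with vertex set $Z(R)^*$ in which two distinct vertices $x,y$ are adjacent if and only if $ann_R(xy)\neq ann_R(x)\cup ann_R(y)$. A graph is planar if it has genus $0$, i.e. can be embedded in the sphere; for arbitrary (also infinite) graphs the paper uses Kuratowski's criterion: a graph is planar if and only if it contains no subdivision of $K_{3,3}$ or $K_5$. *)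

(* Defs.v *)
From HB Require Import structures.
From mathcomp Require Import all_boot all_order all_algebra.
From mathcomp Require Import all_classical.

Set Implicit Arguments.
Unset Strict Implicit.
Unset Printing Implicit Defensive.

Import GRing.Theory.
Local Open Scope classical_set_scope.
Local Open Scope ring_scope.

Section CommutativeRings.
Variable R : comNzRingType.
Implicit Types x y : R.

(* Z(R); since 1 != 0 in R, this set contains 0. *)
Definition zero_divisors : set R :=
  [set x | exists2 y, y != 0 & x * y = 0].

Definition nilradical : set R := [set x | exists n : nat, x ^+ n = 0].

Definition non_reduced : Prop := exists2 x, x \in nilradical & x != 0.

Definition ann x : set R := [set r | r * x = 0].

Definition Ann (A : set R) : set R := [set r | forall z, A z -> r * z = 0].

(* idealr_closed includes properness: 1 \notin I. *)
Definition is_prime_ideal (I : set R) : Prop :=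
  idealr_closed (mem I) /\ prime_idealr_closed (mem I).

End CommutativeRings.

Arguments zero_divisors R : clear implicits.
Arguments nilradical R : clear implicits.
Arguments non_reduced R : clear implicits.

Definition ring_isomorphic (R S : nzRingType) : Prop :=
  exists f : {rmorphism R -> S}, bijective f.

(* The vertex type is the subtype of R of nonzero zero-divisors. *)
Definition AG_vertex (R : comNzRingType) :=
  set_type (zero_divisors R `\ (0 : R)).

Definition AG (R : comNzRingType) : rel (AG_vertex R) := fun x y =>
  (x != y) && (ann (val x * val y) != ann (val x) `|` ann (val y)).

Lemma AG_irreflexive (R : comNzRingType) : irreflexive (@AG R).
Proof. by move=> x; rewrite /AG eqxx. Qed.

Lemma AG_symmetric (R : comNzRingType) : symmetric (@AG R).
Proof. by move=> x y; rewrite /AG eq_sym mulrC setUC. Qed.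

(* The graph e contains, as a subgraph, a subdivision of the simple graph h on
   'I_n: b gives the branch vertices, and the edge {i, j} of h, represented by
   the pair with i < j, becomes a path of e from b i to b j whose internal
   vertices, in order, are p i j (empty if the edge is not subdivided). *)
Definition contains_subdivision (V : eqType) (e : rel V)
    (n : nat) (h : rel 'I_n) : Prop :=
  exists (b : 'I_n -> V) (p : 'I_n -> 'I_n -> seq V),
  [/\ injective b,
      forall i j : 'I_n, (i < j)%N -> h i j ->
        [/\ path e (b i) (rcons (p i j) (b j)),
            uniq (p i j)
          & forall k, b k \notin p i j]
    & forall i j k l : 'I_n, (i < j)%N -> h i j -> (k < l)%N -> h k l ->
        (i, j) != (k, l) -> forall v, v \in p i j -> v \notin p k l].

Definition K5 : rel 'I_5 := fun i j => i != j.

Definition K33 : rel 'I_6 := fun i j => (i < 3)%N != (j < 3)%N.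

(* Kuratowski's criterion, taken as the definition of planarity for graphs of
   arbitrary cardinality. *)
Definition planar (V : eqType) (e : rel V) : Prop :=
  ~ contains_subdivision e K33 /\ ~ contains_subdivision e K5.

(* Main.v *)
Require Import Defs.
From HB Require Import structures.
From mathcomp Require Import all_boot all_order all_algebra.
From mathcomp Require Import finmap all_classical.
From mathcomp Require Import ring.

Set Implicit Arguments.
Unset Strict Implicit.
Unset Printing Implicit Defensive.

Import GRing.Theory.
Local Open Scope classical_set_scope.
Local Open Scope card_scope.
Local Open Scope ring_scope.

(** Two vertices x and y of AG(R) are adjacent exactly when they are distinct
    and some r kills x * y without killing x or y ([linked] below); every
    adjacency used here comes with an explicit such r.

    Suppose AG(R) is planar and write Z for the zero-divisors and N for the
    nilradical.  Nonzero nilpotents are pairwise adjacent ([nil_linked]), so the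
    absence of K5 bounds N by five elements.  Two cases follow.

    First case: some zero-divisor e fixes a nonzero nilpotent w, e * w = w.  If
    the powers e, e^2, e^3 were distinct, they would form a K33 with 1 - e,
    1 - e^2, 1 - e^3; so e^2 is idempotent ([planar_fixing_idempotent]).  Let now
    e be that idempotent and w * w = 0.  The vertices e, e + w, w are adjacent
    to every c with c * w = 0 and (1 - e) * c != 0; hence 1 - e and 1 - e + w are
    the only such c ([planar_complement]), and applying this to suitable c
    computes R completely ([planar_idempotent_local4]): R is F_2 times a local
    ring with the four elements 0, w, e, e + w.  The ring is then determined by
    whether 2 * e is 0 or w, which gives the two rings of the first alternative.

    Second case: no zero-divisor fixes a nonzero nilpotent.  Then the powers of
    a zero-divisor z outside N are distinct as soon as z kills a nonzero
    nilpotent, and K33 subgraphs made of such powers force in turn that Z \ N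
    kills N ([non_nilpotent_annihilates]), that Ann(Z) = N is prime, and that N
    has at most three elements ([non_nilpotent_prime]).  If Z = N instead, only
    the size of N is left to distinguish.

    Conversely, under the first or second alternative all edges of AG(R) meet a
    set of at most two vertices, which excludes subdivisions of K33 and K5
    ([small_cover_planar]); under the third alternative there are at most four
    vertices. *)

(** * Cardinality by duplicate-free sequences *)

Lemma card_ge_IIP (T : choiceType) (A : set T) n :
  `I_n #<= A <->
  exists s : seq T, [/\ uniq s, size s = n & forall x, x \in s -> A x].
Proof.
split=> [/card_subP[C Cn CA]|[s [us sn sA]]].
  have Cfin : finite_set C by apply/finite_setP; exists n.
  exists (enum_fset (fset_set C)); split=> [||x].
  - exact: fset_uniq.
  - exact: card_fset_set.
  - by rewrite in_fset_set // inE => /CA.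
apply/card_subP; exists [set` [fset x in s]%fset]; last first.
  by move=> x /=; rewrite !inE => /sA.
by apply/card_eq_fsetP; rewrite card_fseq undup_id.
Qed.

Lemma card_le_IIP (T : choiceType) (A : set T) n :
  A #<= `I_n <-> forall s : seq T,
    uniq s -> (forall x, x \in s -> A x) -> (size s <= n)%N.
Proof.
split=> [An s us sA|small].
  rewrite -card_le_II; apply: card_le_trans An.
  by apply/card_ge_IIP; exists s.
case: (pselect (finite_set A)) => [/finite_setP[m Am]|/infiniteP Ainf].
  have /card_eqPle[_ /card_ge_IIP[s [us sm /(small s us) sn]]] := Am.
  by rewrite (card_le_eql Am) card_le_II -sm.
have /card_ge_IIP[s [us sn /(small s us)]] : `I_n.+1 #<= A.
  exact: card_le_trans (subset_card_le (fun=> _)) Ainf.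
by rewrite sn ltnn.
Qed.

Lemma nonzero_part (R : comNzRingType) (A : set R) (s : seq R) n :
    uniq s -> (forall x, x \in s -> A x) -> (n < size s)%N ->
  exists t, [/\ uniq t, size t = n & forall x, x \in t -> A x /\ x != 0].
Proof.
move=> us sA ns; exists (take n (rem 0 s)); split.
- by rewrite take_uniq // rem_uniq.
- rewrite size_takel // ; have := size_subseq (rem_subseq 0 s).
  by case: (boolP (0 \in s)) => [/size_rem->|/rem_id->]; case: (s) ns => //= *; rewrite ltnW.
- by move=> x /mem_take; rewrite mem_rem_uniq // inE => /andP[-> /sA].
Qed.

(** * Subdivisions of K33 and K5 *)

Section Subdivisions.
Variables (V : eqType) (e : rel V).

Lemma subgraph_subdivision n (h : rel 'I_n) (b : 'I_n -> V) :
  injective b -> (forall i j : 'I_n, (i < j)%N -> h i j -> e (b i) (b j)) ->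
  contains_subdivision e h.
Proof.
move=> binj bh; exists b, (fun _ _ => [::]); split=> // i j ij hij.
by split=> //=; rewrite bh.
Qed.

(** Every path replacing an edge contains an edge of e, hence a vertex c (i, j)
    of the cover C; two such paths only share branch vertices, so c (i, j) can
    be a common value only at a common end. *)
Lemma subdivided_edge_meets_cover n (h : rel 'I_n) (C : V -> Prop) :
    (forall x y, e x y -> C x \/ C y) -> contains_subdivision e h ->
  exists (b : 'I_n -> V) (c : 'I_n * 'I_n -> V),
    [/\ injective b,
     forall i j : 'I_n, (i < j)%N -> h i j -> C (c (i, j)) &
     forall i j k l : 'I_n, (i < j)%N -> h i j -> (k < l)%N -> h k l ->
       (i, j) != (k, l) -> c (i, j) = c (k, l) ->
       exists m, [/\ c (i, j) = b m, m \in [:: i; j] & m \in [:: k; l]]].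
Proof.
move=> cover [b [p [binj bp pdisj]]]; exists b.
have /choice[c cP] (ij : 'I_n * 'I_n) : exists v, (ij.1 < ij.2)%N ->
    h ij.1 ij.2 -> C v /\ v \in b ij.1 :: rcons (p ij.1 ij.2) (b ij.2).
  case: ij => i j /=.
  have [ij|] := boolP ((i < j)%N && h i j); last first.
    by move=> nij; exists (b i) => lt_ij hij; rewrite lt_ij hij in nij.
  have /andP[lt_ij hij] := ij; have [+ _ _] := bp i j lt_ij hij.
  case: (p i j) => [|y q] /= /andP[/cover[Cx|Cy] _].
  - by exists (b i); rewrite mem_head.
  - by exists (b j); rewrite !inE eqxx orbT.
  - by exists (b i); rewrite mem_head.
  - by exists y; rewrite !inE eqxx orbT.
exists c; split=> // [i j ij hij|i j k l ij hij kl hkl ijkl].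
  by have [] := cP (i, j) ij hij.
have [_ /= cij] := cP (i, j) ij hij; have [_ /= ckl] := cP (k, l) kl hkl.
move=> eqc; rewrite -eqc in ckl; move: (c (i, j)) cij ckl => v.
have [_ _ bij] := bp i j ij hij; have [_ _ bkl] := bp k l kl hkl.
rewrite !inE !mem_rcons !inE.
(* The case where the common vertex is an end of the first path. *)
have dij m : m \in [:: i; j] -> v = b m -> [|| v == b k, v == b l | v \in p k l] ->
    exists m, [/\ v = b m, m \in [:: i; j] & m \in [:: k; l]].
  move=> mij ->; rewrite (negbTE (bkl m)) orbF !(inj_eq binj) => mkl.
  by exists m; rewrite mij !inE.
case/or3P => [/eqP vi|/eqP vj|vp].
- by apply: dij vi; rewrite mem_head.
- by apply: dij vj; rewrite !inE eqxx orbT.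
case/or3P => [/eqP vk|/eqP vl|vq].
- by rewrite vk (negbTE (bij k)) in vp.
- by rewrite vl (negbTE (bij l)) in vp.
- by have := pdisj _ _ _ _ ij hij kl hkl ijkl _ vp; rewrite vq.
Qed.

(** A cover with two vertices cannot serve three disjoint subdivided edges, as
    in a perfect matching of K33.  In K5 it cannot serve the edge {3, 4} and the
    triangle {0, 1, 2}: one cover vertex is spent on {3, 4}, and a single vertex
    cannot lie on all three sides of a subdivided triangle. *)
Lemma small_cover_planar (C : V -> Prop) :
    (forall x y, e x y -> C x \/ C y) ->
    (forall x y z, C x -> C y -> C z -> [\/ x = y, x = z | y = z]) ->
  planar e.
Proof.
move=> cover small; split=> /(subdivided_edge_meets_cover cover)[b [c [binj cC cm]]].
  pose o k := inord k : 'I_6.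
  have ov k : (k < 6)%N -> o k = k :> nat by move=> ?; rewrite inordK.
  have edge k : (k < 3)%N -> (o k < o (k + 3)%N)%N /\ K33 (o k) (o (k + 3)%N).
    by case: k => [|[|[|]]] //= _; rewrite /K33 !ov.
  have sep k l : (k < 3)%N -> (l < 3)%N -> k != l ->
      c (o k, o (k + 3)%N) <> c (o l, o (l + 3)%N).
    move=> k3 l3 kl ckl; have [kk hk] := edge k k3; have [ll hl] := edge l l3.
    have okl i j : (i < 6)%N -> (j < 6)%N -> (o i == o j) = (i == j).
      by move=> i6 j6; rewrite -val_eqE /= !ov.
    case: (cm _ _ _ _ kk hk ll hl _ ckl) => [|m [_]].
      by case: k l k3 l3 kl {kk hk ll hl ckl}
        => [|[|[|]]] //= [|[|[|]]] //= *; rewrite xpair_eqE !okl.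
    rewrite !inE => /orP[] /eqP->; rewrite !okl;
      by case: k l k3 l3 kl {kk hk ll hl ckl} => [|[|[|]]] //= [|[|[|]]].
  have [k0 h0] := edge 0%N isT; have [k1 h1] := edge 1%N isT.
  have [k2 h2] := edge 2%N isT.
  by case: (small _ _ _ (cC _ _ k0 h0) (cC _ _ k1 h1) (cC _ _ k2 h2)); exact: sep.
pose o k := inord k : 'I_5.
have lt35 k : (k < 3)%N -> (k < 5)%N by move=> k3; apply: leq_trans k3 _.
have ov k : (k < 5)%N -> o k = k :> nat by move=> ?; rewrite inordK.
have okl i j : (i < 5)%N -> (j < 5)%N -> (o i == o j) = (i == j).
  by move=> i6 j6; rewrite -val_eqE /= !ov.
have edge k l : (k < l)%N -> (l < 5)%N -> (o k < o l)%N /\ K5 (o k) (o l).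
  move=> kl l5; have k5 := ltn_trans kl l5.
  by rewrite /K5 !ov // okl // ltn_eqF.
have [[a1 a2] [b1 b2]] := (edge 0 1 isT isT, edge 0 2 isT isT)%N.
have [[c1 c2] [d1 d2]] := (edge 1 2 isT isT, edge 3 4 isT isT)%N.
have sep i j : (i < j)%N -> (j < 3)%N -> c (o i, o j) <> c (o 3%N, o 4%N).
  move=> ij j3 cij; have [ij1 ij2] := edge i j ij (lt35 _ j3).
  case: (cm _ _ _ _ ij1 ij2 d1 d2 _ cij) => [|m [_]].
    by case: i j ij j3 {cij ij1 ij2} => [|[|i]] [|[|[|j]]] //= _ _; rewrite xpair_eqE !okl.
  rewrite !inE => /orP[] /eqP->; rewrite !okl;
    by case: i j ij j3 {cij ij1 ij2} => [|[|i]] [|[|[|j]]].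
(* The vertex spent on {3, 4} is unavailable to the triangle. *)
have same i j k l : (i < j)%N -> (j < 3)%N -> (k < l)%N -> (l < 3)%N ->
    c (o i, o j) = c (o k, o l).
  move=> ij j3 kl l3.
  have [ij1 ij2] := edge i j ij (lt35 _ j3).
  have [kl1 kl2] := edge k l kl (lt35 _ l3).
  case: (small _ _ _ (cC _ _ ij1 ij2) (cC _ _ kl1 kl2) (cC _ _ d1 d2)) => //.
    by move=> /sep-/(_ ij j3).
  by move=> /sep-/(_ kl l3).
(* The sides {0, 1} and {1, 2} only share the corner 1, and {0, 1} and {0, 2}
   the corner 0. *)
have [m [m1 m2 m3]] : exists m,
    [/\ c (o 0%N, o 1%N) = b m, m \in [:: o 0%N; o 1%N] & m \in [:: o 1%N; o 2%N]].
  by apply: cm => //; [rewrite xpair_eqE !okl|exact: same].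
have [m' [m'1 m'2 m'3]] : exists m,
    [/\ c (o 0%N, o 1%N) = b m, m \in [:: o 0%N; o 1%N] & m \in [:: o 0%N; o 2%N]].
  by apply: cm => //; [rewrite xpair_eqE !okl|exact: same].
have mm' : m = m' by apply: binj; rewrite -m1.
move: m2 m3 m'3; rewrite -{m' m'1 m'2}mm' !inE.
by move=> /orP[] /eqP->; rewrite !okl.
Qed.

End Subdivisions.

(** * Adjacency in the annihilator graph *)

Lemma eq_addr_self (V : zmodType) (x y : V) : (x == x + y) = (y == 0).
Proof. by rewrite -[X in X == _]addr0 (inj_eq (addrI x)) eq_sym. Qed.

Section Linked.
Variable R : comNzRingType.
Implicit Types x y z r : R.

Definition linked x y := exists r, [/\ r * x != 0, r * y != 0 & r * (x * y) = 0].

Lemma linked_sym x y : linked x y -> linked y x.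
Proof. by case=> r [rx ry rxy]; exists r; rewrite [y * x]mulrC. Qed.

Lemma linked_mul0 x y : x != 0 -> y != 0 -> x * y = 0 -> linked x y.
Proof. by move=> x0 y0 xy; exists 1; rewrite !mul1r. Qed.

(** The witness r also shows that x is a zero-divisor, so that linked elements
    are vertices without further hypotheses. *)
Lemma linked_vertex x y : linked x y -> (zero_divisors R `\ (0 : R)) x.
Proof.
case=> r [rx ry rxy]; split; last by move=> x0; rewrite x0 mulr0 eqxx in rx.
by exists (r * y) => //; rewrite mulrCA.
Qed.

(** Since ann x and ann y are always contained in ann (x * y), inequality means
    that some r lies in the latter only. *)
Lemma AG_linkedP (u v : AG_vertex R) :
  reflect (u != v /\ linked (val u) (val v)) (AG u v).
Proof.
rewrite /AG; set x := val u; set y := val v.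
apply: (iffP andP) => -[uv xy]; split=> //.
  apply: contrapT => nlink; move/eqP: xy; apply; apply/seteqP; split=> r /=.
    move=> rxy; apply: contrapT => /not_orP[rx ry]; apply: nlink.
    by exists r; split=> //; apply/eqP.
  by rewrite /ann /= => -[rx|ry]; [rewrite mulrA rx mul0r | rewrite mulrCA ry mulr0].
case: xy => r [rx ry rxy]; apply/eqP => annU.
have : (ann x `|` ann y) r by rewrite -annU.
by case=> /eqP; rewrite -[_ == _]/(_ * _ == 0) ?(negbTE rx) ?(negbTE ry).
Qed.

Lemma lift_vertices (s : seq R) :
    (forall x, x \in s -> (zero_divisors R `\ (0 : R)) x) ->
  exists t : seq (AG_vertex R), map val t = s.
Proof.
elim: s => [|x s IHs] sV; first by exists [::].
have [y ys|t ts] := IHs; first by apply: sV; rewrite inE ys orbT.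
have xV : x \in zero_divisors R `\ (0 : R) by rewrite inE; apply/sV/mem_head.
by exists (exist _ x xV :: t); rewrite /= ts.
Qed.

Lemma linked_subdivision n (h : rel 'I_n) (s : seq R) :
    size s = n -> uniq s ->
    (forall x, x \in s -> (zero_divisors R `\ (0 : R)) x) ->
    (forall i j : 'I_n, (i < j)%N -> h i j -> linked s`_i s`_j) ->
  contains_subdivision (@AG R) h.
Proof.
move=> sn us /lift_vertices[t ts] sh; have tn : size t = n by rewrite -sn -ts size_map.
case: t ts tn => [|v t] ts tn.
  have n0 (i : 'I_n) : False by case: i => i; rewrite -tn.
  by apply: (@subgraph_subdivision _ _ _ _ (fun i => False_rect _ (n0 i))) => i;
     case: (n0 i).
have sE (i : 'I_n) : s`_i = val (nth v (v :: t) i).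
  by rewrite -ts (nth_map v) // tn.
have ut : uniq (v :: t) by rewrite -(map_inj_uniq val_inj) ts.
have binj : injective (fun i : 'I_n => nth v (v :: t) i).
  by move=> i j /eqP; rewrite nth_uniq ?tn // => /eqP/val_inj.
apply: (subgraph_subdivision binj) => i j ij hij; apply/AG_linkedP; split.
  by rewrite (inj_eq binj) -val_eqE /= ltn_eqF.
by rewrite -!sE; exact: sh.
Qed.

Lemma linked_K33_not_planar (X Y : seq R) :
    size X = 3%N -> size Y = 3%N -> uniq (X ++ Y) ->
    (forall x y, x \in X -> y \in Y -> linked x y) ->
  ~ planar (@AG R).
Proof.
move=> X3 Y3 uXY XY [+ _]; apply; apply: (@linked_subdivision _ _ (X ++ Y)) => //.
- by rewrite size_cat X3 Y3.
- move=> x; rewrite mem_cat => /orP[xX|xY].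
    by apply: (@linked_vertex _ Y`_0); apply: XY => //; rewrite mem_nth ?Y3.
  by apply: (@linked_vertex _ X`_0); apply/linked_sym/XY => //; rewrite mem_nth ?X3.
move=> i j ij; rewrite /K33 !nth_cat X3.
case: ltnP => i3; case: ltnP => j3 // _.
  by apply: XY; rewrite mem_nth ?X3 ?Y3 // ltn_subLR.
by have := leq_trans ij (ltnW (leq_trans j3 i3)); rewrite ltnn.
Qed.

Lemma linked_K5_not_planar (X : seq R) :
    size X = 5%N -> uniq X ->
    (forall x y, x \in X -> y \in X -> x != y -> linked x y) ->
  ~ planar (@AG R).
Proof.
move=> X5 uX XX [_ +]; apply; apply: (@linked_subdivision _ _ X) => //.
  case: X X5 uX XX => [|x [|y X]] // _ /= /andP[xX _] XX z zX.
  have xy : x != y by apply: contraNneq xX => ->; apply: mem_head.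
  have [->|zx] := eqVneq z x.
    by apply: (@linked_vertex _ y); apply: XX => //; rewrite !inE eqxx ?orbT.
  by apply: (@linked_vertex _ x); apply: XX => //; rewrite mem_head.
by move=> i j ij _; apply: XX; rewrite ?mem_nth ?X5 // nth_uniq ?X5 // ltn_eqF.
Qed.

End Linked.

(** * Nilpotent elements *)

Section Nilpotents.
Variable R : comNzRingType.
Implicit Types (x y z a w e : R) (s : seq R).

Lemma last_nonzero_power x a : (exists n, x ^+ n * a = 0) -> a != 0 ->
  exists k, x ^+ k * a != 0 /\ x ^+ k.+1 * a = 0.
Proof.
move=> [n xna] a0; have ex : exists n, x ^+ n * a == 0 by exists n; rewrite xna.
case: (ex_minnP ex) => -[|k] /eqP xka kmin.
  by rewrite mul1r in xka; rewrite xka eqxx in a0.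
exists k; split=> //; apply/negP => /kmin; by rewrite ltnn.
Qed.

Lemma nilradical_mul x y : nilradical R y -> nilradical R (x * y).
Proof. by case=> n yn; exists n; rewrite exprMn yn mulr0. Qed.

Lemma nilradical_exp x i : nilradical R (x ^+ i) -> nilradical R x.
Proof. by case=> k xk; exists (i * k)%N; rewrite exprM. Qed.

Lemma nilradical0 : nilradical R 0.
Proof. by exists 1%N. Qed.

Lemma nil_mul_fixed x y : nilradical R y -> x * y = x -> x = 0.
Proof.
case=> n yn xy; suff xyk k : x * y ^+ k = x by rewrite -(xyk n) yn mulr0.
by elim: k => [|k IHk]; rewrite ?mulr1 // exprS mulrA xy.
Qed.

Lemma nilradical_zero_divisor x : nilradical R x -> zero_divisors R x.
Proof.
case=> n xn; have [||k [xk xk1]] := @last_nonzero_power x 1; last 1 first.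
- by exists (x ^+ k * 1); rewrite // mulrA -exprS.
- by exists n; rewrite xn mul0r.
- exact: oner_neq0.
Qed.

(** With x^i the last power of x not killing y and y^j the last power of y not
    killing x, the witness is x^i if it does not kill x, y^j if it does not kill
    y, and otherwise x^i + y^j, whose products with x and y are x * y^j and
    x^i * y. *)
Lemma nil_linked x y : nilradical R x -> nilradical R y -> x != 0 -> y != 0 ->
  linked x y.
Proof.
move=> [m xm] [n yn] x0 y0.
have [|//|i [xiy xi1y]] := @last_nonzero_power x y.
  by exists m; rewrite xm mul0r.
have [|//|j [yjx yj1x]] := @last_nonzero_power y x.
  by exists n; rewrite yn mul0r.
have [xi1|xi1] := eqVneq (x ^+ i.+1) 0; last first.
  by exists (x ^+ i); rewrite -exprSr mulrA -exprSr.
have [yj1|yj1] := eqVneq (y ^+ j.+1) 0; last first.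
  by exists (y ^+ j); rewrite -exprSr [x * y]mulrC mulrA -exprSr.
exists (x ^+ i + y ^+ j); rewrite !mulrDl -exprSr -exprSr xi1 yj1 addr0 add0r.
by rewrite xiy yjx mulrA -exprSr xi1 mulrCA -exprSr yj1 mul0r mulr0 addr0.
Qed.

Lemma planar_card_nilradical : planar (@AG R) -> nilradical R #<= `I_5.
Proof.
move=> pl; apply/card_le_IIP => s us sN; rewrite leqNgt; apply/negP => s5.
have [t [ut t5 tN]] := nonzero_part us sN s5.
apply: (linked_K5_not_planar t5 ut) pl => x y /tN[xN x0] /tN[yN y0] _.
exact: nil_linked.
Qed.

Lemma zero_divisors_exp x n : zero_divisors R x -> (0 < n)%N ->
  zero_divisors R (x ^+ n).
Proof.
case=> y y0 xy; case: n => // n _; exists y => //.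
by rewrite exprSr -mulrA xy mulr0.
Qed.

End Nilpotents.

(** * The product of F_2 and a local ring with four elements *)

Definition Z2_local4_coord (R : comNzRingType) (e w : R) (a : bool * bool * bool) : R :=
  (1 - e) *+ a.1.1 + e *+ a.1.2 + w *+ a.2.

(** The idempotent e is the unit of the local factor and w its nonzero
    nilpotent; t tells whether that factor is like Z/4 (2 * e = w) or has
    characteristic 2. *)
Record Z2_local4 (R : comNzRingType) (t : bool) (e w : R) : Prop := {
  local4_idem : e * e = e;
  local4_neq1 : e != 1;
  local4_fix : e * w = w;
  local4_sqr0 : w * w = 0;
  local4_neq0 : w != 0;
  local4_double_compl : (1 - e) *+ 2 = 0;
  local4_double : e *+ 2 = w *+ t;
  local4_double_nil : w *+ 2 = 0;
  local4_cover : forall x, exists a, x = Z2_local4_coord e w a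
}.

(** The operation tables of R in coordinates.  They depend on t only, which is why
    two such rings with the same t are isomorphic. *)
Definition coord_add t (a b : bool * bool * bool) :=
  (a.1.1 (+) b.1.1, a.1.2 (+) b.1.2, a.2 (+) b.2 (+) [&& t, a.1.2 & b.1.2]).

Definition coord_mul (a b : bool * bool * bool) :=
  (a.1.1 && b.1.1, a.1.2 && b.1.2, (a.1.2 && b.2) (+) (a.2 && b.1.2)).

Section Local4.
Variables (R : comNzRingType) (t : bool) (e w : R).
Hypothesis H : Z2_local4 t e w.
Local Notation f := (1 - e).
Local Notation coord := (Z2_local4_coord e w).

Let ee := local4_idem H.
Let ew := local4_fix H.
Let ww := local4_sqr0 H.

Let fe : f * e = 0. Proof. by rewrite mulrBl mul1r ee subrr. Qed.
Let ff : f * f = f. Proof. by rewrite mulrBr mulr1 fe subr0. Qed.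
Let fw : f * w = 0. Proof. by rewrite mulrBl mul1r ew subrr. Qed.

Let addb2 (x : R) (i j : bool) : x *+ i + x *+ j = x *+ (i (+) j) + x *+ 2 *+ (i && j).
Proof. by case: i; case: j; rewrite ?mulr0n ?mulr1n ?addr0 ?add0r. Qed.

Lemma coordD a b : coord a + coord b = coord (coord_add t a b).
Proof.
case: a b => [[i j] k] [[i' j'] k']; rewrite /Z2_local4_coord /coord_add /=.
have -> : f *+ i + e *+ j + w *+ k + (f *+ i' + e *+ j' + w *+ k') =
  (f *+ i + f *+ i') + (e *+ j + e *+ j') + (w *+ k + w *+ k') by ring.
rewrite !addb2 (local4_double_compl H) (local4_double H) (local4_double_nil H).
rewrite !mul0rn !addr0 -!addrA; congr (_ + (_ + _)).
have w2 : w + w = 0 by rewrite -mulr2n (local4_double_nil H).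
by case: (t); case: j; case: j'; case: k; case: k';
  rewrite /= ?mulr0n ?mulr1n ?addr0 ?add0r ?w2.
Qed.

Lemma coordM a b : coord a * coord b = coord (coord_mul a b).
Proof.
case: a b => [[i j] k] [[i' j'] k']; rewrite /Z2_local4_coord /coord_mul /=.
have ef : e * f = 0 by rewrite mulrC.
have wf : w * f = 0 by rewrite mulrC.
have we : w * e = w by rewrite mulrC.
have mulb (x y : R) (b c : bool) : x *+ b * (y *+ c) = (x * y) *+ (b && c).
  by case: b; case: c; rewrite ?mulr0n ?mulr1n ?mul0r ?mulr0.
rewrite !mulrDl !mulrDr !mulb ee ff fe ef ew we fw wf ww !mul0rn !addr0 !add0r.
have w2 : w + w = 0 by rewrite -mulr2n (local4_double_nil H).
rewrite -!addrA; congr (_ + (_ + _)).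
by case: j; case: j'; case: k; case: k';
  rewrite /= ?mulr0n ?mulr1n ?addr0 ?add0r ?w2.
Qed.

Lemma coord1 : coord (true, true, false) = 1.
Proof. by rewrite /Z2_local4_coord /= !mulr1n addr0 subrK. Qed.

Lemma coord0 : coord (false, false, false) = 0.
Proof. by rewrite /Z2_local4_coord /= !mulr0n !addr0. Qed.

Lemma coord_inj : injective coord.
Proof.
have binj (x : R) (b c : bool) : x != 0 -> x *+ b = x *+ c -> b = c.
  move=> /negP x0; case: b; case: c => //; rewrite mulr1n mulr0n => xb0; case: x0.
    by rewrite xb0.
  by rewrite -xb0.
have e0 : e != 0.
  by apply: contraNneq (local4_neq0 H) => e0; rewrite -ew e0 mul0r.
have f0 : f != 0 by rewrite subr_eq0 eq_sym (local4_neq1 H).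
have w0 := local4_neq0 H.
move=> [[i j] k] [[i' j'] k'] eqc.
have /(binj _ _ _ f0) ii : f *+ i = f *+ i'.
  have := congr1 ( *%R f) eqc; rewrite /Z2_local4_coord /= !mulrDr !mulrnAr.
  by rewrite ff fe fw !mul0rn !addr0.
have /(binj _ _ _ w0) jj : w *+ j = w *+ j'.
  have := congr1 ( *%R w) eqc; rewrite /Z2_local4_coord /= !mulrDr !mulrnAr.
  by rewrite ww [w * e]mulrC ew [w * f]mulrC fw !mul0rn !addr0 !add0r.
by move: eqc; rewrite ii jj => /addrI/(binj _ _ _ w0) /= ->.
Qed.

(** By injectivity of the coordinates this is a finite check.  AG(R) is in fact
    the complete bipartite graph between {f, f + w} and {e, e + w, w}. *)
Lemma coord_linked_cover x y : x != y -> linked x y ->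
  (x = f \/ x = f + w) \/ (y = f \/ y = f + w).
Proof.
case: (local4_cover H x) (local4_cover H y) => [a ->] [b ->].
rewrite (inj_eq coord_inj) => ab [r].
case: (local4_cover H r) => [c ->] []; rewrite !coordM -coord0 !(inj_eq coord_inj).
have -> : f = coord (true, false, false).
  by rewrite /Z2_local4_coord /= mulr1n !mulr0n !addr0.
have -> : coord (true, false, false) + w = coord (true, false, true).
  by rewrite /Z2_local4_coord /= !mulr1n !mulr0n !addr0.
move=> ca cb /coord_inj cab.
suff : (a \in [:: (true, false, false); (true, false, true)])
    || (b \in [:: (true, false, false); (true, false, true)]).
  by rewrite !inE => /orP[] /orP[] /eqP->; tauto.
by move: a b c ab ca cb cab => [[[] []] []] [[[] []] []] [[[] []] []].
Qed.

Lemma local4_planar : planar (@AG R).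
Proof.
apply: (@small_cover_planar _ _ (fun v => val v = f \/ val v = f + w)).
  by move=> u v /AG_linkedP[uv]; apply: coord_linked_cover; rewrite (inj_eq val_inj).
move=> x y z; have eqv (u v : AG_vertex R) (c : R) : val u = c -> val v = c -> u = v.
  by move=> uc vc; apply/val_inj; rewrite uc vc.
case=> [xc|xc] [yc|yc] [zc|zc]; do ?[by apply: Or31; apply: eqv xc yc|
  by apply: Or32; apply: eqv xc zc|by apply: Or33; apply: eqv yc zc].
Qed.

End Local4.

Lemma local4_isomorphic (R S : comNzRingType) t (e w : R) (e' w' : S) :
  Z2_local4 t e w -> Z2_local4 t e' w' -> ring_isomorphic R S.
Proof.
move=> HR HS.
have [g gK] := choice (local4_cover HR); have [g' g'K] := choice (local4_cover HS).
pose phi x : S := Z2_local4_coord e' w' (g x).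
pose psi y : R := Z2_local4_coord e w (g' y).
have phiE a : phi (Z2_local4_coord e w a) = Z2_local4_coord e' w' a.
  by congr Z2_local4_coord; apply: (coord_inj HR); rewrite -gK.
have psiE a : psi (Z2_local4_coord e' w' a) = Z2_local4_coord e w a.
  by congr Z2_local4_coord; apply: (coord_inj HS); rewrite -g'K.
have phi_nmod : nmod_morphism phi.
  split; first by rewrite -(coord0 e w) phiE coord0.
  by move=> x y; rewrite (gK x) (gK y) (coordD HR) !phiE (coordD HS).
have phi_monoid : monoid_morphism phi.
  split; first by rewrite -(coord1 e w) phiE coord1.
  by move=> x y; rewrite (gK x) (gK y) (coordM HR) !phiE (coordM HS).
pose F : {rmorphism R -> S} := HB.pack phi
  (GRing.isNmodMorphism.Build R S phi phi_nmod)
  (GRing.isMonoidMorphism.Build R S phi phi_monoid).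
exists F; exists psi => [x|y] /=.
  by rewrite (gK x) phiE psiE.
by rewrite (g'K y) psiE phiE.
Qed.

Lemma local4_transport (R S : comNzRingType) t (e w : S) :
  ring_isomorphic R S -> Z2_local4 t e w ->
  exists e' w' : R, Z2_local4 t e' w'.
Proof.
case=> phi [psi phiK psiK] H; exists (psi e), (psi w).
have inj : injective phi := can_inj phiK.
split; try (apply: inj; rewrite ?rmorphM ?rmorphMn ?rmorphB ?rmorph0 ?rmorph1 !psiK).
- exact: local4_idem H.
- by rewrite -(inj_eq inj) rmorph1 psiK (local4_neq1 H).
- exact: local4_fix H.
- exact: local4_sqr0 H.
- by rewrite -(inj_eq inj) rmorph0 psiK (local4_neq0 H).
- exact: local4_double_compl H.
- exact: local4_double H.
- exact: local4_double_nil H.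
- move=> x; have [a xa] := local4_cover H (phi x); exists a; apply: inj.
  by rewrite xa /Z2_local4_coord !rmorphD !rmorphMn rmorphB rmorph1 !psiK.
Qed.

Lemma Z2Z4_local4 : @Z2_local4 ('Z_2 * 'Z_4)%type true (0, 1) (0, 2%:R).
Proof.
split; try by apply/eqP.
move=> [[x xlt] [y ylt]]; exists (x == 1%N, odd y, (1 < y)%N); apply/eqP.
by move: x y xlt ylt => [|[|x]] // [|[|[|[|y]]]].
Qed.

Lemma Z2dual_local4 :
  @Z2_local4 ('Z_2 * {poly %/ ('X^2 : {poly 'Z_2})})%type false (0, 1) (0, 'qX).
Proof.
set h : {poly 'Z_2} := 'X^2.
have Z2 (c : 'Z_2) : c = (c == 1)%:R by apply/eqP; case: c => [[|[|c]] clt].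
have Xh : 'qX = in_qpoly h 'X by [].
have mkh : mk_monic h = 'X^2 by rewrite mk_monic_Xn.
have X0 : 'qX != 0 :> {poly %/ h}.
  rewrite -val_eqE /= mkh Pdiv.CommonRing.rmodp_small ?polyX_eq0 //.
  by rewrite size_polyX size_polyXn.
have XX : 'qX * 'qX = 0 :> {poly %/ h}.
  rewrite Xh -in_qpolyM -expr2; apply/val_inj; rewrite /= mkh.
  by rewrite Pdiv.RingMonic.rmodpp ?monicXn.
have two0 (p : {poly %/ h}) : p *+ 2 = 0.
  rewrite -mulr_natl; suff -> : 2%:R = 0 :> {poly %/ h} by rewrite mul0r.
  rewrite -(rmorph_nat (in_qpoly h)) -polyC_natr.
  by have -> : 2%:R = 0 :> 'Z_2; [apply/eqP | rewrite !rmorph0].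
(* Every class has a representative a + b X, with a and b in {0, 1}. *)
have pE (p : {poly %/ h}) : exists a b : bool, p = 1 *+ a + 'qX *+ b.
  exists (p`_0 == 1), (p`_1 == 1).
  move Ea: (p`_0 == 1) => a; move Eb: (p`_1 == 1) => b.
  have -> : p = in_qpoly h (val p).
    by apply/val_inj/esym/in_qpoly_small/size_mk_monic.
  rewrite Xh -(in_qpoly1 h) -!rmorphMn -rmorphD; congr in_qpoly.
  have sp : (size (val p) <= 2)%N.
    by rewrite -ltnS; apply: leq_trans (size_mk_monic p) _; rewrite mkh size_polyXn.
  apply/polyP => i; rewrite coefD coefMn /= coefC coefX.
  case: i => [|[|i]]; rewrite ?mul0rn ?addr0 ?add0r -?Ea -?Eb; try exact: Z2.
  by rewrite nth_default // (leq_trans sp).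
pose S := ('Z_2 * {poly %/ h})%type.
have pM (a c : 'Z_2) (b d : {poly %/ h}) : (a, b) * (c, d) = (a * c, b * d) :> S by [].
have pD (a c : 'Z_2) (b d : {poly %/ h}) : (a, b) + (c, d) = (a + c, b + d) :> S by [].
have char2 (x : S) : x *+ 2 = 0.
  case: x => a b; rewrite mulr2n pD -!mulr2n two0; congr (_, _).
  by apply/eqP; case: a => [[|[|a]] alt].
split; rewrite ?char2 ?mulr0n ?pM ?mul1r ?mul0r ?XX //.
move=> [a p]; have [j [k ->]] := pE p; exists (a == 1, j, k).
have f10 : 1 - (0, 1) = (1, 0) :> S.
  by rewrite -[LHS]/(1 - 0, 1 - 1) subr0 subrr.
rewrite [a in LHS]Z2 /Z2_local4_coord f10.
by case: (a == 1) j k => [] [] []; rewrite /= ?mulr0n ?mulr1n ?addr0 ?add0r ?pD ?addr0 ?add0r.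
Qed.

(** * A zero-divisor fixing a nonzero nilpotent *)

Section IdempotentCase.
Variable R : comNzRingType.
Implicit Types x y a c e w : R.

(** If e^2 is not idempotent, then e, e^2, e^3 are distinct, and so are their complements to 1.  With
    e * a = 0 and a != 0, the element a + w sends each e^i to w and each 1 - e^j
    to a, and kills their products, giving a K33. *)
Lemma planar_fixing_idempotent e w : planar (@AG R) -> zero_divisors R e ->
  w != 0 -> e * w = w -> e ^+ 2 * e ^+ 2 = e ^+ 2.
Proof.
move=> pl [a a0 ea] w0 ew; apply: contrapT => idem.
have ekw k : e ^+ k * w = w by elim: k => [|k IHk]; rewrite ?mul1r // exprSr -mulrA ew.
have eka k : (0 < k)%N -> e ^+ k * a = 0.
  by case: k => // k _; rewrite exprSr -mulrA ea mulr0.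
have e12 : e != e ^+ 2.
  by apply/eqP => e12; apply: idem; rewrite -e12 -expr2.
have e13 : e != e ^+ 3.
  by apply/eqP => e13; apply: idem; rewrite -exprD -[(2 + 2)%N]/(1 + 3)%N exprD -e13.
have e23 : e ^+ 2 != e ^+ 3.
  by apply/eqP => e23; apply: idem; rewrite -exprD -[(2 + 2)%N]/(1 + 3)%N exprD -e23 -exprS.
pose X := [:: e; e ^+ 2; e ^+ 3]; pose Y := [:: 1 - e; 1 - e ^+ 2; 1 - e ^+ 3].
have XP x : x \in X -> exists2 k, (0 < k)%N & x = e ^+ k.
  rewrite !inE => /or3P[] /eqP->; [exists 1%N|exists 2%N|exists 3%N] => //.
have YP y : y \in Y -> exists2 k, (0 < k)%N & y = 1 - e ^+ k.
  rewrite !inE => /or3P[] /eqP->; [exists 1%N|exists 2%N|exists 3%N] => //.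
apply: (@linked_K33_not_planar R X Y) pl => //; last first.
  move=> x y /XP[i i0 ->] /YP[j j0 ->]; exists (a + w).
  have rx : (a + w) * e ^+ i = w by rewrite mulrC mulrDr eka // ekw add0r.
  have ry : (a + w) * (1 - e ^+ j) = a.
    by rewrite mulrC mulrDr !mulrBl eka // ekw !mul1r subrr subr0 addr0.
  by rewrite rx ry mulrA rx mulrBr mulr1 [w * _]mulrC ekw subrr.
rewrite cat_uniq; apply/and3P; split.
- by rewrite /= !inE negb_or e12 e13 e23.
- apply/hasPn => y /YP[j j0 ->]; apply/negP => /XP[i i0 /(congr1 (fun x => x * a))].
  by rewrite mulrBl !eka // mul1r subr0 => /eqP; rewrite (negbTE a0).
- have inj x y : x != y -> 1 - x != 1 - y by rewrite (inj_eq (addrI 1)) eqr_opp.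
  by rewrite /= !inE negb_or !inj.
Qed.

(** Write f = 1 - e.  Such a c is linked to w because c * w = 0, and to e and
    e + w through r = f + w, which sends both to w and c to f * c.  Both f and
    f + w are of this kind, so a further c would complete a K33. *)
Lemma planar_complement e w c : planar (@AG R) -> e * e = e ->
    e * w = w -> w * w = 0 -> w != 0 -> e != 1 ->
    c * w = 0 -> (1 - e) * c != 0 ->
  c = 1 - e \/ c = 1 - e + w.
Proof.
move=> pl ee ew ww w0 e1 cw fc; apply: contrapT => /not_orP[/eqP cf /eqP cfw].
set f := 1 - e in fc cf cfw *.
have fe : f * e = 0 by rewrite mulrBl mul1r ee subrr.
have ff : f * f = f by rewrite mulrBr mulr1 fe subr0.
have fw : f * w = 0 by rewrite mulrBl mul1r ew subrr.
have f0 : f != 0 by rewrite subr_eq0 eq_sym.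
clearbody f.
have fww : (f + w) * w = 0 by rewrite mulrDl fw ww addr0.
have fwe : (f + w) * e = w by rewrite mulrDl fe add0r mulrC.
have xlink x y : x \in [:: e; e + w; w] -> y * w = 0 -> f * y != 0 -> linked x y.
  move=> xX yw fy.
  have ry : (f + w) * y = f * y by rewrite mulrDl [w * y]mulrC yw addr0.
  have rx z : (f + w) * z = w -> linked z y.
    by move=> rz; exists (f + w); rewrite rz ry mulrA rz [w * y]mulrC yw.
  move: xX; rewrite !inE => /or3P[] /eqP->.
  - exact: rx.
  - by apply: rx; rewrite mulrDr fwe fww addr0.
  - apply: linked_mul0; rewrite 1?mulrC //.
    by apply: contraNneq fy => ->; rewrite mulr0.
have fX x : x \in [:: e; e + w; w] -> f * x = 0.
  by rewrite !inE => /or3P[] /eqP->; rewrite ?mulrDr ?fe ?fw ?addr0.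
have YP y : y \in [:: f; f + w; c] -> y * w = 0 /\ f * y != 0.
  rewrite !inE => /or3P[] /eqP->; split=> //; rewrite ?fww ?mulrDr ?ff ?fw ?addr0 //.
apply: (@linked_K33_not_planar R [:: e; e + w; w] [:: f; f + w; c]) pl => //; last first.
  by move=> x y xX /YP[]; apply: xlink.
rewrite cat_uniq; apply/and3P; split.
- have ew' : e != w.
    by apply: contraNneq w0 => ew'; rewrite -ew {1}ew' ww.
  have eww : e + w != w.
    rewrite -subr_eq0 addrK; apply: contraNneq w0 => e0; by rewrite -ew e0 mul0r.
  by rewrite /= !inE negb_or ew' eww eq_addr_self w0.
- by apply/hasPn => y /YP[_ fy]; apply/negP => /fX /eqP; rewrite (negbTE fy).
- by rewrite /= !inE negb_or eq_addr_self w0 ![_ == c]eq_sym cf cfw.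
Qed.

(** Suitable choices of c in [planar_complement] compute R.  Taking c = f * x shows
    that f * R = {0, f}; taking c = f + e * x shows that the part of e * R killed
    by w is {0, w}; this part contains x * w for every x, so that w kills x
    or x - 1, and e * R = {0, w, e, e + w}. *)
Lemma planar_idempotent_local4 e w : planar (@AG R) -> e * e = e ->
    e * w = w -> w * w = 0 -> w != 0 -> e != 1 ->
  exists t, Z2_local4 t e w.
Proof.
move=> pl ee ew ww w0 e1.
have compl c := @planar_complement e w c pl ee ew ww w0 e1.
set f := 1 - e in compl.
have fe : f * e = 0 by rewrite mulrBl mul1r ee subrr.
have ef : e * f = 0 by rewrite mulrC.
have ff : f * f = f by rewrite mulrBr mulr1 fe subr0.
have fw : f * w = 0 by rewrite mulrBl mul1r ew subrr.
have f0 : f != 0 by rewrite subr_eq0 eq_sym.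
have xfe x : x = f * x + e * x by rewrite -mulrDl subrK mul1r.
have fE : 1 - e = f by [].
clearbody f.
have fx x : f * x = 0 \/ f * x = f.
  have [|fx0] := eqVneq (f * x) 0; [by left|right].
  case: (compl (f * x)) => //; first by rewrite mulrAC fw mul0r.
    by rewrite mulrA ff.
  move=> /(congr1 ( *%R e)); rewrite mulrA ef mul0r mulrDr ef add0r ew => /eqP.
  by rewrite eq_sym (negbTE w0).
have annw x : x * w = 0 -> e * x = 0 \/ e * x = w.
  move=> xw; case: (compl (f + e * x)).
  - by rewrite mulrDl fw add0r -mulrA xw mulr0.
  - by rewrite mulrDr ff mulrA fe mul0r addr0.
  - by rewrite -[RHS]addr0 => /addrI; left.
  - by move=> /addrI; right.
have wx x : x * w = 0 \/ x * w = w.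
  have [] := annw (x * w); first by rewrite -mulrA ww mulr0.
    by rewrite mulrCA ew; left.
  by rewrite mulrCA ew; right.
have ex x : exists j k : bool, e * x = e *+ j + w *+ k.
  have [xw|xw] := wx x.
    case: (annw x xw) => ->; [exists false, false|exists false, true];
      by rewrite ?mulr0n ?mulr1n ?addr0 ?add0r.
  have : (x - 1) * w = 0 by rewrite mulrBl mul1r xw subrr.
  case/annw; rewrite mulrBr mulr1 => /eqP; rewrite subr_eq => /eqP->;
    [exists true, false|exists true, true];
    by rewrite ?mulr0n ?mulr1n ?addr0 ?add0r // addrC.
have w2 : w *+ 2 = 0.
  rewrite -mulr_natl; case: (wx 2%:R) => // /eqP.
  by rewrite mulr_natl mulr2n -subr_eq0 addrK (negbTE w0).
have f2 : f *+ 2 = 0.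
  rewrite -mulr_natr; case: (fx 2%:R) => // /eqP.
  by rewrite mulr_natr mulr2n -subr_eq0 addrK (negbTE f0).
have [t e2] : exists t : bool, e *+ 2 = w *+ t.
  rewrite -[in e *+ 2](mulr_natr e 2).
  by case: (annw 2%:R); rewrite ?mulr_natl // => ->; [exists false|exists true].
exists t; split; rewrite ?fE // => x.
have [j [k exjk]] := ex x.
have [i fxi] : exists i : bool, f * x = f *+ i.
  by case: (fx x) => ->; [exists false|exists true].
by exists (i, j, k); rewrite /Z2_local4_coord fE /= -addrA -exjk -fxi -xfe.
Qed.

(** The last nonzero power of w is still fixed by e and has square zero. *)
Lemma planar_fixing_local4 e w : planar (@AG R) -> zero_divisors R e ->
    nilradical R w -> w != 0 -> e * w = w ->
  exists t e' w', @Z2_local4 R t e' w'.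
Proof.
move=> pl eZ [n wn] w0 ew.
have ee := planar_fixing_idempotent pl eZ w0 ew.
have [|//|k [wk wk1]] := @last_nonzero_power R w w.
  by exists n; rewrite wn mul0r.
have [t H] : exists t, Z2_local4 t (e ^+ 2) (w ^+ k * w).
  apply: planar_idempotent_local4 => //.
  - by rewrite mulrCA expr2 -mulrA !ew.
  - by rewrite -mulrA [w * _]mulrA -exprS wk1 mulr0.
  - case: (zero_divisors_exp eZ (isT : 0 < 2)%N) => a a0 ea.
    by apply: contraNneq a0 => e1; rewrite -ea e1 mul1r.
by exists t, (e ^+ 2), (w ^+ k * w).
Qed.

End IdempotentCase.

(** * The annihilator of the zero-divisors *)

Section Annihilator.
Variable R : comNzRingType.
Hypothesis hR : non_reduced R.
Implicit Types x y z n u v r w e : R.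
Local Notation Z := (zero_divisors R).
Local Notation N := (nilradical R).

Lemma nonzero_nilpotent : exists2 w, N w & w != 0.
Proof. by case: hR => w wN w0; exists w; rewrite // -inE. Qed.

(** An element x of Ann(Z) kills the nonzero nilpotents, so it is itself a
    zero-divisor and x * x = 0. *)
Lemma Ann_nilradical : (forall n z, N n -> Z z -> n * z = 0) -> Ann Z = N.
Proof.
move=> NZ; have [w wN w0] := nonzero_nilpotent.
apply/seteqP; split=> [x xZ|n nN z zZ]; last exact: NZ.
exists 2%N; rewrite expr2; apply: (xZ x); exists w => //.
exact/xZ/nilradical_zero_divisor.
Qed.

Lemma Ann_prime : (forall u v, Ann Z (u * v) -> Ann Z u \/ Ann Z v) ->
  is_prime_ideal (Ann Z).
Proof.
move=> pr; split; last first.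
  by move=> u v; rewrite !inE => /pr[uZ|vZ]; apply/orP; [left|right]; apply/asboolP.
have [w wN w0] := nonzero_nilpotent.
split=> [||a x y]; rewrite ?inE /=.
- by move=> z _; rewrite mul0r.
- apply/asboolPn => /(_ w (nilradical_zero_divisor wN)).
  by rewrite mul1r => w0'; rewrite w0' eqxx in w0.
- by move=> xZ yZ z zZ; rewrite mulrDl -mulrA xZ // yZ // mulr0 addr0.
Qed.

Lemma Ann_prime_nilradical : is_prime_ideal (Ann Z) -> Ann Z = N.
Proof.
case=> [[_ Ann1 _] pr]; apply: Ann_nilradical => n z [k nk] zZ.
have nA : n ^+ k \in Ann Z by rewrite nk inE => y _; rewrite mul0r.
suff : n \in Ann Z by rewrite inE; apply.
elim: k nA {nk} => [nA|k IHk]; first by case/negP: Ann1; exact: nA.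
by rewrite exprS => /pr /orP[|/IHk].
Qed.

(** An edge u - v outside the prime ideal N = Ann(Z) is impossible: its witness r
    has r * (u * v) = 0, so r lies in Ann(Z) and kills u.  Hence the at most two
    nonzero nilpotents cover all edges. *)
Lemma Ann_prime_planar : is_prime_ideal (Ann Z) -> N #<= `I_3 -> planar (@AG R).
Proof.
move=> Apr N3; have AN := Ann_prime_nilradical Apr; case: Apr => _ pr.
apply: (@small_cover_planar _ _ (fun v : AG_vertex R => N (val v))).
  move=> u v /AG_linkedP[_ [r [ru rv ruv]]]; apply: contrapT => /not_orP[uN vN].
  have prN a b : N (a * b) -> N a \/ N b.
    by rewrite -AN => /mem_set/pr /orP[] /set_mem; [left|right].
  have rN : N r.
    have /prN[//|/prN[//|//]] : N (r * (val u * val v)) by exists 1%N.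
  move: rN; rewrite -AN => /(_ (val u)) ru0; case/eqP: ru; apply: ru0.
  by have [] := set_valP u.
move=> x y z xN yN zN.
have [|xy] := eqVneq x y; first by constructor.
have [|xz] := eqVneq x z; first by constructor.
have [|yz] := eqVneq y z; first by constructor.
have nz (v : AG_vertex R) : 0 == val v = false.
  by apply/negbTE/eqP => v0; have [_] := set_valP v; apply.
have /card_le_IIP := N3.
move=> /(_ [:: 0; val x; val y; val z]) /=.
rewrite !inE !nz !(inj_eq val_inj) (negbTE xy) (negbTE xz) (negbTE yz) /=.
move=> /(_ isT) small; suff : (4 <= 3)%N by [].
apply: small => t; rewrite !inE => /or4P[] /eqP-> //.
by exists 1%N.
Qed.

Lemma few_vertices_planar : Z = N -> N #<= `I_5 -> planar (@AG R).
Proof.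
move=> ZN /card_le_IIP N5.
suff no (k : nat) (h : rel 'I_k) : (4 < k)%N -> ~ contains_subdivision (@AG R) h.
  by split; apply: no.
move=> n4 [b [_ [binj _ _]]].
have := N5 (0 :: [seq val (b i) | i <- enum 'I_k]).
rewrite /= size_map size_enum_ord map_inj_uniq ?enum_uniq; last first.
  by move=> i j /val_inj/binj.
rewrite andbT => N5'; suff : (k < 5)%N by rewrite ltnNge n4.
apply: N5' => [|x].
  apply/mapP => -[i _ b0]; have [_] := set_valP (b i); apply; exact/esym.
rewrite inE => /predU1P[->|/mapP[i _ ->]]; first by exists 1%N.
by rewrite -ZN; have [] := set_valP (b i).
Qed.

(** If x * y != 0 then 0, x, x * y and x + x * y are distinct, because 1 - y and
    1 + y are units. *)
Lemma small_nilradical_sqr0 x y : N #<= `I_3 -> N x -> N y -> x * y = 0.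
Proof.
move=> /card_le_IIP N3 xN yN; apply/eqP; apply: contraT => xy.
have x0 : x != 0 by apply: contraNneq xy => ->; rewrite mul0r.
have xxy : x != x * y.
  by apply: contraNneq x0 => /esym /(nil_mul_fixed yN)->.
have x1y : x + x * y != 0.
  apply: contraNneq x0 => /eqP; rewrite addr_eq0 eq_sym -mulrN => /eqP xNy.
  by apply/eqP/(nil_mul_fixed _ xNy); rewrite -mulN1r; apply: nilradical_mul.
have := N3 [:: 0; x; x * y; x + x * y].
rewrite /= !inE ![0 == _]eq_sym (negbTE x0) (negbTE xy) (negbTE x1y).
rewrite (negbTE xxy) eq_addr_self [x + _]addrC eq_addr_self.
rewrite (negbTE xy) (negbTE x0) => /(_ isT) small.
suff : (4 <= 3)%N by []; apply: small => t; rewrite !inE => /or4P[] /eqP->.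
- by exists 1%N.
- by [].
- exact: nilradical_mul.
- by rewrite -[X in _ + X]mulr1 -mulrDr mulrC; apply: nilradical_mul.
Qed.

(** * No zero-divisor fixes a nonzero nilpotent *)

Section NoFixedNilpotent.
Hypothesis pl : planar (@AG R).
Hypothesis nofix : forall e w, Z e -> N w -> w != 0 -> e * w != w.

(** If z^i = z^j with i < j, then 1 - z^(j - i) is a zero-divisor, and it
    fixes w. *)
Lemma non_nilpotent_exp_inj z w i j : Z z -> ~ N z -> N w -> w != 0 ->
  z * w = 0 -> z ^+ i = z ^+ j -> i = j.
Proof.
move=> zZ zN wN w0 zw; wlog: i j / (i <= j)%N.
  move=> lt; case: (leqP i j) => [ij|/ltnW ij]; first exact: lt.
  by move=> /esym/(lt _ _ ij).
rewrite leq_eqVlt => /predU1P[//|ij] zij; exfalso.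
have zi0 : z ^+ i != 0 by apply/eqP => zi0; apply: zN; exists i.
have : Z (1 - z ^+ (j - i)).
  exists (z ^+ i) => //; rewrite mulrBl mul1r -exprD subnK 1?ltnW //.
  by rewrite zij subrr.
move=> /nofix/(_ wN w0)/eqP; apply.
have -> : (j - i = (j - i).-1.+1)%N by rewrite prednK // subn_gt0.
by rewrite mulrBl mul1r exprSr -mulrA zw mulr0 subr0.
Qed.

Lemma exp_map_uniq z w (s : seq nat) : Z z -> ~ N z -> N w -> w != 0 ->
  z * w = 0 -> uniq s -> uniq [seq z ^+ i | i <- s].
Proof.
move=> zZ zN wN w0 zw us; rewrite map_inj_uniq // => i j.
exact: non_nilpotent_exp_inj zw.
Qed.

Lemma non_nilpotent_exp z i : ~ N z -> ~ N (z ^+ i).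
Proof. by move=> zN /nilradical_exp. Qed.

(** The elements z^k * n cannot all be nonzero: N is finite, so two of them would
    coincide and a power of z would fix a nonzero nilpotent.  If z * n != 0,
    the last two nonzero elements m and s = z * m of this sequence are killed by
    z^2, and m, s, m + s form a K33 with z^2, z^3, z^4. *)
Lemma non_nilpotent_annihilates z n : Z z -> ~ N z -> N n -> z * n = 0.
Proof.
move=> zZ zN nN; apply/eqP; apply: contraT => zn.
have n0 : n != 0 by apply: contraNneq zn => ->; rewrite mulr0.
have [|//|[|k] [zk zk1]] := @last_nonzero_power R z n.
- apply: contrapT => /forallNP nz.
  have := planar_card_nilradical pl => /card_le_IIP/(_ (mkseq (fun k => z ^+ k * n) 6)).
  rewrite size_mkseq => small; have [us|] := boolP (uniq (mkseq (fun k => z ^+ k * n) 6)).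
    suff : (6 <= 5)%N by []; apply: small => // x /mapP[k _ ->].
    exact: nilradical_mul.
  move/(uniqPn 0) => [i [j [ij]]]; rewrite size_mkseq => j6.
  rewrite !nth_mkseq // ?(ltn_trans ij) // => zij.
  have zi0 : z ^+ i * n != 0 by apply/eqP.
  have /nofix/(_ (nilradical_mul (z ^+ i) nN) zi0)/eqP[] : Z (z ^+ (j - i)).
    by apply: zero_divisors_exp; rewrite ?subn_gt0.
  by rewrite mulrA -exprD subnK // ltnW.
- by rewrite expr1 in zk1; rewrite zk1 eqxx in zn.
set m := z ^+ k * n in zk1; set s := z * m.
have s0 : s != 0 by rewrite /s mulrA -exprS.
have zs : z * s = 0 by rewrite /s /m [z * (z ^+ k * n)]mulrA -exprS mulrA -exprS.
have mN : N m by apply: nilradical_mul.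
have zm j : z ^+ j.+2 * m = 0 by rewrite exprSr -mulrA -/s exprSr -mulrA zs mulr0.
have m0 : m != 0 by apply: contraNneq s0 => m0; rewrite /s m0 mulr0.
have ms0 : m + s != 0.
  by apply: contraNneq s0 => /(congr1 ( *%R z)); rewrite mulrDr zs addr0 mulr0 => zm0; rewrite /s zm0.
exfalso; pose X := [:: m; s; m + s]; pose Y := [seq z ^+ j | j <- [:: 2; 3; 4]%N].
have XP x : x \in X -> exists2 y, x = y * m & x != 0.
  rewrite !inE => /or3P[] /eqP->; [exists 1|exists z|exists (1 + z)] => //.
    by rewrite mul1r.
  by rewrite mulrDl mul1r.
have YP y : y \in Y -> exists j, y = z ^+ j.+2.
  by rewrite !inE => /or3P[] /eqP->; eexists.
have sN : N s by apply: nilradical_mul.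
apply: (@linked_K33_not_planar R X Y) pl => //; last first.
  move=> x y /XP[t -> t0] /YP[j ->]; apply: linked_mul0 => //.
    by apply/eqP => zj; apply: (@non_nilpotent_exp z j.+2 zN); rewrite zj; exact: nilradical0.
  by rewrite -mulrA [m * _]mulrC zm mulr0.
rewrite cat_uniq (exp_map_uniq zZ zN sN s0 zs) // andbT; apply/andP; split.
- have ms : m != s by apply: contraNneq s0 => ms; rewrite -zs -ms; apply/eqP.
  by rewrite /= !inE negb_or ms eq_addr_self s0 addrC eq_addr_self m0.
- apply/hasPn => y /YP[j ->]; apply/negP => /XP[t zt _].
  by apply: (@non_nilpotent_exp z j.+2 zN); rewrite zt; apply: nilradical_mul.
Qed.

(** N * N = 0: for y in N the sum z0 + y is again a non-nilpotent zero-divisor,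
    so z0 and z0 + y both kill N.  Thus Ann(Z) = N.  If u * v is in N while u and
    v are not, then u^2 * v^2 = 0 and the powers of u and v from the second on
    form a K33.  Three nonzero nilpotents would form a K33 with the powers
    of z0. *)
Lemma non_nilpotent_prime z0 : Z z0 -> ~ N z0 ->
  is_prime_ideal (Ann Z) /\ N #<= `I_3.
Proof.
move=> z0Z z0N; have [w wN w0] := nonzero_nilpotent.
have NN x y : N x -> N y -> x * y = 0.
  move=> xN yN; have [->|y0] := eqVneq y 0; first by rewrite mulr0.
  have [|//|k [yk yk1]] := @last_nonzero_power R y y.
    by case: yN => k yk; exists k; rewrite yk mul0r.
  have ykN : N (y ^+ k * y) by apply: nilradical_mul.
  (* The last nonzero power of y is killed by z0 and by y. *)
  have zyZ : Z (z0 + y).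
    exists (y ^+ k * y) => //.
    by rewrite mulrDl non_nilpotent_annihilates // mulrA -exprS yk1 addr0.
  have zyN : ~ N (z0 + y).
    move=> /(nilradical_mul z0); rewrite mulrDr [z0 * y]non_nilpotent_annihilates //.
    by rewrite addr0 -expr2 => /nilradical_exp.
  have := non_nilpotent_annihilates zyZ zyN xN.
  by rewrite mulrDl non_nilpotent_annihilates // add0r mulrC.
have AN : Ann Z = N.
  apply: Ann_nilradical => n z nN zZ; have [zN|zN] := pselect (N z); first exact: NN.
  by rewrite mulrC non_nilpotent_annihilates.
have Zmul x y : x != 0 -> y * (y * x) = 0 -> Z y.
  by move=> x0 yyx; have [yx|yx] := eqVneq (y * x) 0; [exists x|exists (y * x)].
split.
  apply: Ann_prime => u v; rewrite AN => uvN; apply: contrapT => /not_orP[uN vN].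
  have sq_neq0 x : ~ N x -> x ^+ 2 != 0 by move=> xN; apply/eqP => x2; apply: xN; exists 2%N.
  have uv2 : u ^+ 2 * v ^+ 2 = 0 by rewrite -exprMn expr2 NN.
  have uZ : Z u by apply: (Zmul (v ^+ 2)); rewrite ?sq_neq0 // mulrA.
  have vZ : Z v by apply: (Zmul (u ^+ 2)); rewrite ?sq_neq0 // mulrA mulrC.
  have uw := non_nilpotent_annihilates uZ uN wN.
  have vw := non_nilpotent_annihilates vZ vN wN.
  have uv i j : u ^+ i.+2 * v ^+ j.+2 = 0.
    by rewrite -addn2 -[j.+2]addn2 !exprD mulrACA uv2 mulr0.
  pose P z := [seq z ^+ j | j <- [:: 2; 3; 4]%N].
  have PP z x : x \in P z -> exists j, x = z ^+ j.+2.
    by rewrite !inE => /or3P[] /eqP->; eexists.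
  have neq0 z j : ~ N z -> z ^+ j.+2 != 0.
    by move=> zN; apply/eqP => zj; apply: zN; exists j.+2.
  apply: (@linked_K33_not_planar R (P u) (P v)) pl => //; last first.
    by move=> x y /PP[i ->] /PP[j ->]; apply: linked_mul0; rewrite ?neq0.
  rewrite cat_uniq (exp_map_uniq uZ uN wN w0 uw) // (exp_map_uniq vZ vN wN w0 vw) //.
  rewrite andbT; apply/hasPn => y /PP[j ->]; apply/negP => /PP[i vu].
  by apply: vN; exists (j.+2 + j.+2)%N; rewrite exprD {1}vu uv.
apply/card_le_IIP => s us sN; rewrite leqNgt; apply/negP => s3.
have [X [uX X3 XN]] := nonzero_part us sN s3.
pose Y := [seq z0 ^+ j | j <- [:: 1; 2; 3]%N].
have YP y : y \in Y -> exists j, y = z0 ^+ j.+1.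
  by rewrite !inE => /or3P[] /eqP->; eexists.
apply: (@linked_K33_not_planar R X Y) pl => //; last first.
  move=> x y /XN[xN x0] /YP[j ->]; apply: linked_mul0 => //.
    by apply/eqP => zj; apply: z0N; exists j.+1.
  by rewrite exprSr mulrCA [x * _]mulrC [z0 * x]non_nilpotent_annihilates // mulr0.
rewrite cat_uniq uX (exp_map_uniq z0Z z0N wN w0 (non_nilpotent_annihilates z0Z z0N wN)) //.
rewrite andbT; apply/hasPn => y /YP[j ->]; apply/negP => /XN[+ _].
exact: non_nilpotent_exp.
Qed.

End NoFixedNilpotent.

Lemma nilradical_zero_divisors_prime : Z = N -> N #<= `I_3 ->
  is_prime_ideal (Ann Z).
Proof.
move=> ZN N3; apply: Ann_prime => u v.
rewrite Ann_nilradical => [|n z nN]; last first.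
  by rewrite ZN; apply: small_nilradical_sqr0.
rewrite -ZN => -[y y0 uvy]; have [vy|vy] := eqVneq (v * y) 0.
  by right; exists y.
by left; exists (v * y); rewrite ?mulrA.
Qed.

End Annihilator.

(** * Planar annihilator graphs *)

Theorem theorem9 (R : comNzRingType) (hR : non_reduced R) :
  planar (@AG R) <->
  [\/ ring_isomorphic R ('Z_2 * 'Z_4)%type
      \/ ring_isomorphic R ('Z_2 * {poly %/ ('X^2 : {poly 'Z_2})})%type,
      is_prime_ideal (Ann (zero_divisors R))
      /\ (`I_2 #<= nilradical R) && (nilradical R #<= `I_3)
    | zero_divisors R = nilradical R
      /\ (`I_4 #<= nilradical R) && (nilradical R #<= `I_5)].
Proof.
split=> [pl|[[iso|iso]|[pr /andP[_ N3]]|[ZN /andP[_ N5]]]]; last 4 first.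
- by have [e [w /local4_planar]] := local4_transport iso Z2Z4_local4.
- by have [e [w /local4_planar]] := local4_transport iso Z2dual_local4.
- exact: Ann_prime_planar.
- exact: few_vertices_planar.
have [[e [w [eZ wN w0 ew]]]|nofix] := pselect (exists e w : R,
    [/\ zero_divisors R e, nilradical R w, w != 0 & e * w = w]).
  apply: Or31; have [[] [e' [w' H]]] := planar_fixing_local4 pl eZ wN w0 ew.
    by left; apply: local4_isomorphic H Z2Z4_local4.
  by right; apply: local4_isomorphic H Z2dual_local4.
have N2 : `I_2 #<= nilradical R.
  have [w wN w0] := nonzero_nilpotent hR; apply/card_ge_IIP; exists [:: 0; w].
  split=> // [|x]; first by rewrite /= inE eq_sym w0.
  by rewrite !inE => /orP[] /eqP-> //; exists 1%N.
have [[z [zZ zN]]|ZN] := pselect (exists z, zero_divisors R z /\ ~ nilradical R z).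
  apply: Or32; have [|pr N3] := @non_nilpotent_prime R hR pl _ z zZ zN.
    by move=> e w eZ wN w0; apply/eqP => ew; apply: nofix; exists e, w.
  by split=> //; rewrite N2.
have {}ZN : zero_divisors R = nilradical R.
  apply/seteqP; split=> x; last exact: nilradical_zero_divisor.
  by move=> xZ; apply: contrapT => xN; apply: ZN; exists x.
have [N3|N3] := boolP (nilradical R #<= `I_3).
  by apply: Or32; split; [exact: nilradical_zero_divisors_prime|rewrite N2].
apply: Or33; split=> //; rewrite planar_card_nilradical // andbT.
apply: contraNT N3 => N4; apply/card_le_IIP => s us sN; rewrite leqNgt.
apply: contra N4 => s4; apply/card_ge_IIP; exists (take 4 s).
by split=> [||x /mem_take/sN]; rewrite ?take_uniq ?size_takel.
Qed.
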